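(* The GKAT axioms are sound for the language model: for all $e,f\in\mathrm{Exp}$, \[ e\equiv f \quad\Longrightarrow\quad [\![e]\!]=[\![f]\!]. \]
   Context: Syntax. Fix disjoint nonempty sets $\Sigma$ (actions) and $T=\{t_1,\dots,t_n\}$ (primitive tests), $T$ finite. Boolean expressions $b,c\in\mathrm{BExp}$ are generated by $0 \mid 1 \mid t\in T \mid b\cdot c \mid b+c \mid \overline{b}$. GKAT expressions $e,f,g\in\mathrm{Exp}$ are generated by $p\in\Sigma \mid b\in\mathrm{BExp} \mid e\cdot f \mid e+_b f \mid e^{(b)}$; $ef$ abbreviates $e\cdot f$. $\equiv_{BA}$ denotes Boolean equivalence, $b\le c$ iff $b+c\equiv_{BA}c$. $\mathrm{At}$ is the finite set of atoms (minimal nonzero elements) of the free Boolean algebra $\mathrm{BExp}/{\equiv_{BA}}$ on $T$. Language model. Guarded strings: $\mathrm{GS}=\mathrm{At}\cdot(\Sigma\cdot\mathrm{At})^*$. Fusion product: $x\alpha\diamond\beta y = x\alpha y$ if $\alpha=\beta$, undefined otherwise; for $L,K\subseteq\mathrm{GS}$, $L\diamond K=\{x\diamond y : x\in L,y\in K, x\diamond y\text{ defined}\}$; $L^0=\mathrm{At}$, $L^{n+1}=L^n\diamond L$. For $B\subseteq\mathrm{At}$, $\overline{B}=\mathrm{At}\setminus B$, $L+_BK=(B\diamond L)\cup(\overline{B}\diamond K)$, $L^{(B)}=\bigcup_{n\ge0}(B\diamond L)^n\diamond\overline{B}$. Then $[\![-]\!]:\mathrm{Exp}\to 2^{\mathrm{GS}}$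 is: $[\![p]\!]=\{\alpha p\beta:\alpha,\beta\in\mathrm{At}\}$, $[\![b]\!]=\{\alpha\in\mathrm{At}:\alpha\le b\}$, $[\![e\cdot f]\!]=[\![e]\!]\diamond[\![f]\!]$, $[\![e+_bf]\!]=[\![e]\!]+_{[\![b]\!]}[\![f]\!]$, $[\![e^{(b)}]\!]=[\![e]\!]^{([\![b]\!])}$. Axioms. $E:\mathrm{Exp}\to\mathrm{BExp}$ is defined by $E(b)=b$, $E(p)=0$, $E(e+_bf)=b\cdot E(e)+\overline{b}\cdot E(f)$, $E(e\cdot f)=E(e)\cdot E(f)$, $E(e^{(b)})=\overline{b}$. The relation $\equiv$ is the smallest congruence (with respect to all operators) on $\mathrm{Exp}$ such that $b\equiv_{BA}c$ implies $b\equiv c$ and, for all $e,f,g\in\mathrm{Exp}$, $b,c\in\mathrm{BExp}$: (U1) $e+_be\equiv e$; (U2) $e+_bf\equiv f+_{\overline{b}}e$; (U3) $(e+_bf)+_cg\equiv e+_{bc}(f+_cg)$; (U4) $e+_bf\equiv be+_bf$; (U5) $eg+_bfg\equiv(e+_bf)\cdot g$; (S1) $(e\cdot f)\cdot g\equiv e\cdot(f\cdot g)$; (S2) $0\cdot e\equiv0$; (S3) $e\cdot0\equiv0$; (S4) $1\cdot e\equiv e$; (S5) $e\cdot1\equiv e$; (W1) $e^{(b)}\equiv ee^{(b)}+_b1$; (W2) $(e+_c1)^{(b)}\equiv(ce)^{(b)}$; (W3) if $g\equiv eg+_bf$ and $E(e)\equiv0$, then $g\equiv e^{(b)}f$. 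*)

(* Defs.v *)
From mathcomp Require Import all_boot.
From mathcomp Require Import classical_sets.

Set Implicit Arguments.
Unset Strict Implicit.
Unset Printing Implicit Defensive.

Local Open Scope classical_set_scope.

Declare Scope gkat_scope.
Delimit Scope gkat_scope with gkat.
Local Open Scope gkat_scope.

Reserved Notation "b =BA= c" (at level 70, no associativity).
Reserved Notation "b <=BA c" (at level 70, no associativity).
Reserved Notation "e =GKAT= f" (at level 70, no associativity).

Inductive bexp (T : Type) : Type :=
| BZero
| BOne
| BTest of T
| BAnd of bexp T & bexp T
| BOr of bexp T & bexp T
| BNot of bexp T.

Arguments BZero {T}.
Arguments BOne {T}.

(* [Ite b e f] is the guarded union e +_b f, [While b e] the guarded loop
   e^(b). *)
Inductive exp (Sigma T : Type) : Type :=
| Act of Sigma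
| Test of bexp T
| Seq of exp Sigma T & exp Sigma T
| Ite of bexp T & exp Sigma T & exp Sigma T
| While of bexp T & exp Sigma T.

Arguments Act {Sigma T}.
Arguments Test {Sigma T}.

(* The congruence whose quotient is the free Boolean algebra on T: the smallest
   congruence containing the axioms of complemented distributive lattices. *)
Inductive ba_equiv (T : Type) : bexp T -> bexp T -> Prop :=
| ba_refl b : b =BA= b
| ba_sym b c : b =BA= c -> c =BA= b
| ba_trans b c d : b =BA= c -> c =BA= d -> b =BA= d
| ba_congr_and b b' c c' :
    b =BA= b' -> c =BA= c' -> BAnd b c =BA= BAnd b' c'
| ba_congr_or b b' c c' :
    b =BA= b' -> c =BA= c' -> BOr b c =BA= BOr b' c'
| ba_congr_not b b' : b =BA= b' -> BNot b =BA= BNot b'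
| ba_andA b c d : BAnd b (BAnd c d) =BA= BAnd (BAnd b c) d
| ba_orA b c d : BOr b (BOr c d) =BA= BOr (BOr b c) d
| ba_andC b c : BAnd b c =BA= BAnd c b
| ba_orC b c : BOr b c =BA= BOr c b
| ba_and_absorb b c : BAnd b (BOr b c) =BA= b
| ba_or_absorb b c : BOr b (BAnd b c) =BA= b
| ba_and_or b c d : BAnd b (BOr c d) =BA= BOr (BAnd b c) (BAnd b d)
| ba_or_and b c d : BOr b (BAnd c d) =BA= BAnd (BOr b c) (BOr b d)
| ba_and1 b : BAnd b BOne =BA= b
| ba_or0 b : BOr b BZero =BA= b
| ba_andN b : BAnd b (BNot b) =BA= BZero
| ba_orN b : BOr b (BNot b) =BA= BOne
where "b =BA= c" := (ba_equiv b c) : gkat_scope.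

Definition ba_le (T : Type) (b c : bexp T) : Prop := BOr b c =BA= c.
Notation "b <=BA c" := (ba_le b c) : gkat_scope.

(* [a] represents a minimal nonzero element of the quotient. *)
Definition is_atom (T : Type) (a : bexp T) : Prop :=
  ~ (a =BA= BZero) /\
  forall c : bexp T, c <=BA a -> ~ (c =BA= BZero) -> c =BA= a.

(* The elements of the quotient are equivalence classes, so that equality of
   atoms is [=]. *)
Definition atom (T : Type) : Type :=
  {A : set (bexp T) | exists2 a, is_atom a & A = [set x | a =BA= x]}.

Definition atom_le (T : Type) (alpha : atom T) (b : bexp T) : Prop :=
  exists2 a, sval alpha a & a <=BA b.

(* The guarded string alpha_0 p_1 alpha_1 ... p_n alpha_n is
   (alpha_0, [:: (p_1, alpha_1); ...; (p_n, alpha_n)]). *)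
Definition gstring (Sigma T : Type) : Type :=
  (atom T * seq (Sigma * atom T))%type.

Definition gs_first (Sigma T : Type) (x : gstring Sigma T) : atom T := x.1.

Definition gs_last (Sigma T : Type) (x : gstring Sigma T) : atom T :=
  last x.1 (map snd x.2).

Definition lang (Sigma T : Type) : Type := set (gstring Sigma T).

(* The fusion of x and y is defined exactly when [gs_last x = gs_first y]; the
   shared atom is kept once. *)
Definition fusion (Sigma T : Type) (L K : lang Sigma T) : lang Sigma T :=
  [set z | exists x y, [/\ L x, K y, gs_last x = gs_first y
                         & z = (x.1, x.2 ++ y.2)]].

(* The inclusion of 2^At into 2^GS. *)
Definition atoms_lang (Sigma T : Type) (B : set (atom T)) : lang Sigma T :=
  [set x | exists2 alpha, B alpha & x = (alpha, [::])].

Fixpoint lang_pow (Sigma T : Type) (L : lang Sigma T) (n : nat) :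
    lang Sigma T :=
  match n with
  | 0 => atoms_lang setT
  | m.+1 => fusion (lang_pow L m) L
  end.

Definition lang_ite (Sigma T : Type) (B : set (atom T)) (L K : lang Sigma T) :
    lang Sigma T :=
  fusion (atoms_lang B) L `|` fusion (atoms_lang (~` B)) K.

Definition lang_while (Sigma T : Type) (B : set (atom T)) (L : lang Sigma T) :
    lang Sigma T :=
  \bigcup_(n in [set: nat])
    fusion (lang_pow (fusion (atoms_lang B) L) n) (atoms_lang (~` B)).

Definition bsem (T : Type) (b : bexp T) : set (atom T) :=
  [set alpha | atom_le alpha b].

Fixpoint sem (Sigma T : Type) (e : exp Sigma T) : lang Sigma T :=
  match e with
  | Act p => [set x | exists alpha beta, x = (alpha, [:: (p, beta)])]
  | Test b => atoms_lang (bsem b)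
  | Seq e f => fusion (sem e) (sem f)
  | Ite b e f => lang_ite (bsem b) (sem e) (sem f)
  | While b e => lang_while (bsem b) (sem e)
  end.

Fixpoint E (Sigma T : Type) (e : exp Sigma T) : bexp T :=
  match e with
  | Act _ => BZero
  | Test b => b
  | Seq e f => BAnd (E e) (E f)
  | Ite b e f => BOr (BAnd b (E e)) (BAnd (BNot b) (E f))
  | While b _ => BNot b
  end.

(* On paper BExp is a subset of Exp and the product of two tests is one
   expression, whether formed in BExp or in Exp; here [Test (BAnd b c)] and
   [Seq (Test b) (Test c)] are distinct terms, which [gkat_test_and]
   identifies.  For the same reason the congruence rules cover the Boolean
   operators and the guards of [Ite] and [While]. *)
Inductive gkat_equiv (Sigma T : Type) : exp Sigma T -> exp Sigma T -> Prop :=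
| gkat_refl e : e =GKAT= e
| gkat_sym e f : e =GKAT= f -> f =GKAT= e
| gkat_trans e f g : e =GKAT= f -> f =GKAT= g -> e =GKAT= g
| gkat_congr_and b b' c c' :
    Test b =GKAT= Test b' -> Test c =GKAT= Test c' ->
    Test (BAnd b c) =GKAT= Test (BAnd b' c')
| gkat_congr_or b b' c c' :
    Test b =GKAT= Test b' -> Test c =GKAT= Test c' ->
    Test (BOr b c) =GKAT= Test (BOr b' c')
| gkat_congr_not b b' :
    Test b =GKAT= Test b' -> Test (BNot b) =GKAT= Test (BNot b')
| gkat_congr_seq e e' f f' :
    e =GKAT= e' -> f =GKAT= f' -> Seq e f =GKAT= Seq e' f'
| gkat_congr_ite b b' e e' f f' :
    Test b =GKAT= Test b' -> e =GKAT= e' -> f =GKAT= f' ->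
    Ite b e f =GKAT= Ite b' e' f'
| gkat_congr_while b b' e e' :
    Test b =GKAT= Test b' -> e =GKAT= e' -> While b e =GKAT= While b' e'
| gkat_test_and b c : Test (BAnd b c) =GKAT= Seq (Test b) (Test c)
| gkat_ba b c : b =BA= c -> Test b =GKAT= Test c
| gkat_U1 b e : Ite b e e =GKAT= e
| gkat_U2 b e f : Ite b e f =GKAT= Ite (BNot b) f e
| gkat_U3 b c e f g :
    Ite c (Ite b e f) g =GKAT= Ite (BAnd b c) e (Ite c f g)
| gkat_U4 b e f : Ite b e f =GKAT= Ite b (Seq (Test b) e) f
| gkat_U5 b e f g : Ite b (Seq e g) (Seq f g) =GKAT= Seq (Ite b e f) g
| gkat_S1 e f g : Seq (Seq e f) g =GKAT= Seq e (Seq f g)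
| gkat_S2 e : Seq (Test BZero) e =GKAT= Test BZero
| gkat_S3 e : Seq e (Test BZero) =GKAT= Test BZero
| gkat_S4 e : Seq (Test BOne) e =GKAT= e
| gkat_S5 e : Seq e (Test BOne) =GKAT= e
| gkat_W1 b e : While b e =GKAT= Ite b (Seq e (While b e)) (Test BOne)
| gkat_W2 b c e :
    While b (Ite c e (Test BOne)) =GKAT= While b (Seq (Test c) e)
| gkat_W3 b e f g :
    g =GKAT= Ite b (Seq e g) f -> Test (E e) =GKAT= Test BZero ->
    g =GKAT= Seq (While b e) f
where "e =GKAT= f" := (gkat_equiv e f) : gkat_scope.

(* Main.v *)
Require Import Defs.
From mathcomp Require Import all_boot.
From mathcomp Require Import boolp classical_sets.
From Stdlib Require Import Setoid.

(** Soundness is an induction on the derivation.  An atom [alpha] is a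
    two-valued homomorphism [b |-> alpha <= b] on Boolean expressions, so guards
    act on languages by filtering guarded strings on their first atom, and the
    loop axioms reduce to Kleene algebra: [L^(B)] is [(B L)^*] followed by the
    complement of [B].  For W3, [E e = 0] means that no string of [e] is a
    single atom; unfolding [g = e g +_b f] therefore strictly shortens the
    remaining string, which makes the fixpoint unique. *)

Set Implicit Arguments.
Unset Strict Implicit.
Unset Printing Implicit Defensive.

Local Open Scope classical_set_scope.
Local Open Scope gkat_scope.

(* Boolean algebra: the truth value of an expression at an atom *)
Add Parametric Relation (T : Type) : (bexp T) (@ba_equiv T)
  reflexivity proved by (@ba_refl T)
  symmetry proved by (@ba_sym T)
  transitivity proved by (@ba_trans T)
  as ba_equiv_rel.

#[local] Hint Resolve ba_refl : core.

Add Parametric Morphism (T : Type) : (@BAnd T)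
  with signature (@ba_equiv T) ==> (@ba_equiv T) ==> (@ba_equiv T) as BAnd_mor.
Proof. by move=> *; apply: ba_congr_and. Qed.

Add Parametric Morphism (T : Type) : (@BOr T)
  with signature (@ba_equiv T) ==> (@ba_equiv T) ==> (@ba_equiv T) as BOr_mor.
Proof. by move=> *; apply: ba_congr_or. Qed.

Section Boolean.
Variable T : Type.
Implicit Types (a b c : bexp T) (alpha : atom T).

Lemma ba_andxx b : BAnd b b =BA= b.
Proof. by rewrite -{2}(ba_or_absorb b b) ba_and_absorb. Qed.

Lemma ba_and0 b : BAnd b BZero =BA= BZero.
Proof. by rewrite -(ba_andN b) ba_andA ba_andxx. Qed.

Lemma ba_leP b c : b <=BA c <-> BAnd b c =BA= b.
Proof.
rewrite /ba_le; split=> [<-|<-]; first exact: ba_and_absorb.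
by rewrite ba_orC (ba_andC b c) ba_or_absorb.
Qed.

Lemma is_atom_dich a b : is_atom a ->
  BAnd a b =BA= a \/ BAnd a b =BA= BZero.
Proof.
case=> _ min_a; case: (EM (BAnd a b =BA= BZero)) => [|nz]; first by right.
left; apply: min_a => //.
by rewrite /ba_le ba_orC ba_or_absorb.
Qed.

(** Equivalent expressions have the same upper bounds, so one representative of the class decides
    [atom_le] for every [b]. The order becomes an equation, open to setoid rewriting. *)
Lemma atom_leP alpha :
  exists2 a, is_atom a & forall b, atom_le alpha b <-> BAnd a b =BA= a.
Proof.
case: alpha => A [a atom_a AE]; exists a => // b; rewrite /atom_le /= AE.
split=> [[a' /= -> /ba_leP] //|ab]; exists a => //.
exact/ba_leP.
Qed.

Lemma atom_le_and alpha b c :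
  atom_le alpha (BAnd b c) <-> atom_le alpha b /\ atom_le alpha c.
Proof.
have [a _ leE] := atom_leP alpha; rewrite !leE; split=> [abc|[ab ac]].
  split; rewrite -abc; last by rewrite -!ba_andA ba_andxx.
  by rewrite (ba_andC b c) -!ba_andA ba_andxx.
by rewrite ba_andA ab.
Qed.

(** Atoms are prime because they are minimal: if the meet of [a] and [b] is not [a], it is 0, and
    distributivity leaves [BAnd a c] alone. *)
Lemma atom_le_or alpha b c :
  atom_le alpha (BOr b c) <-> atom_le alpha b \/ atom_le alpha c.
Proof.
have [a atom_a leE] := atom_leP alpha; rewrite !leE ba_and_or; split.
  case: (is_atom_dich b atom_a) => [|ab]; first by left.
  by rewrite ab ba_orC ba_or0; right.
by case=> ->; rewrite 1?[BOr _ a]ba_orC ba_or_absorb.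
Qed.

Lemma atom_le0 alpha : ~ atom_le alpha BZero.
Proof.
have [a [nz _] ->] := atom_leP alpha.
by rewrite ba_and0 => a0; apply: nz; symmetry.
Qed.

Lemma atom_le1 alpha : atom_le alpha BOne.
Proof. by have [a _ ->] := atom_leP alpha; apply: ba_and1. Qed.

Lemma atom_le_equiv alpha b c :
  b =BA= c -> atom_le alpha b <-> atom_le alpha c.
Proof. by move=> bc; have [a _ leE] := atom_leP alpha; rewrite !leE bc. Qed.

Lemma atom_leN alpha b : atom_le alpha (BNot b) <-> ~ atom_le alpha b.
Proof.
split=> [lN l|nl].
  apply: (@atom_le0 alpha); apply/(atom_le_equiv alpha (ba_andN b)).
  exact/atom_le_and.
have /atom_le_or[] // : atom_le alpha (BOr b (BNot b)).
exact/(atom_le_equiv alpha (ba_orN b))/atom_le1.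
Qed.

Lemma bsem_and b c : bsem (BAnd b c) = bsem b `&` bsem c.
Proof. by apply/seteqP; split=> alpha /atom_le_and. Qed.

Lemma bsem_or b c : bsem (BOr b c) = bsem b `|` bsem c.
Proof. by apply/seteqP; split=> alpha /atom_le_or. Qed.

Lemma bsem_not b : bsem (BNot b) = ~` bsem b.
Proof. by apply/seteqP; split=> alpha /atom_leN. Qed.

Lemma bsem0 : bsem (@BZero T) = set0.
Proof. by apply/seteqP; split=> alpha // /atom_le0. Qed.

Lemma bsem1 : bsem (@BOne T) = setT.
Proof. by apply/seteqP; split=> alpha // _; apply: atom_le1. Qed.

Lemma bsem_equiv b c : b =BA= c -> bsem b = bsem c.
Proof. by move=> bc; apply/seteqP; split=> alpha /(atom_le_equiv alpha bc). Qed.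

End Boolean.

(** * Algebra of guarded languages: fusion, star, guarded union and loop *)

Section Languages.
Variables Sigma T : Type.
Implicit Types (L K M X : lang Sigma T) (B C : set (atom T)).
Implicit Types x y z : gstring Sigma T.

Local Notation fus := (@fusion Sigma T).
Local Notation "1" := (@atoms_lang Sigma T setT).

Definition lang_star L : lang Sigma T := \bigcup_(n in [set: nat]) lang_pow L n.

(** Rules with a premise between tests give, by induction, an equality of languages; injectivity
    turns it back into an equality of the guards' atom sets. *)
Lemma atoms_lang_inj : injective (@atoms_lang Sigma T).
Proof.
move=> B C BC; apply/seteqP; split=> alpha Halpha.
  have [beta Cbeta [->]//] : atoms_lang C ((alpha, [::]) : gstring Sigma T).
  by rewrite -BC; exists alpha.
have [beta Bbeta [->]//] : atoms_lang B ((alpha, [::]) : gstring Sigma T).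
by rewrite BC; exists alpha.
Qed.

Lemma fusion_guardE B L : fus (atoms_lang B) L = [set x | B x.1 /\ L x].
Proof.
apply/seteqP; split=> [z [x [y [[alpha Balpha ->] Ly /= e ->]]]|[alpha s] [Bz Lz]].
  by case: y Ly e => beta t; rewrite /gs_last /gs_first /= => Ly e; subst beta.
by exists (alpha, [::]), (alpha, s); split=> //; exists alpha.
Qed.

Lemma fusion1l L : fus 1 L = L.
Proof. by rewrite fusion_guardE; apply/seteqP; split=> x // []. Qed.

Lemma fusion1r L : fus L 1 = L.
Proof.
apply/seteqP; split=> [z [x [y [Lx [alpha _ ->] _ ->]]]|x Lx].
  by rewrite /= cats0 -surjective_pairing.
exists x, (gs_last x, [::]); split=> //; first by exists (gs_last x).
by rewrite cats0 -surjective_pairing.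
Qed.

Lemma gs_last_cat x y : gs_last x = gs_first y ->
  gs_last (x.1, x.2 ++ y.2) = gs_last y.
Proof.
by rewrite /gs_last /gs_first /= map_cat last_cat => ->.
Qed.

Lemma fusionA L K M : fus (fus L K) M = fus L (fus K M).
Proof.
apply/seteqP; split=> w.
  move=> [_ [z [[x [y [Lx Ky xy ->]]] Mz + ->]]]; rewrite gs_last_cat // => yz.
  exists x, (y.1, y.2 ++ z.2); split=> //; last by rewrite catA.
  by exists y, z.
move=> [x [_ [Lx [y [z [Ky Mz yz ->]]] xy ->]]].
exists (x.1, x.2 ++ y.2), z; split=> //; last by rewrite catA.
  by exists x, y.
by rewrite gs_last_cat.
Qed.

Lemma fusionSS L L' K K' : L `<=` L' -> K `<=` K' -> fus L K `<=` fus L' K'.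
Proof.
move=> LL' KK' z [x [y [Lx Ky xy ->]]].
by exists x, y; split=> //; [apply: LL'|apply: KK'].
Qed.

Lemma fusionUl L K M : fus (L `|` K) M = fus L M `|` fus K M.
Proof.
apply/seteqP; split; last first.
  by rewrite subUset; split; apply: fusionSS.
by move=> z [x [y [[Lx|Kx] My xy ->]]]; [left|right]; exists x, y.
Qed.

Lemma fusionUr L K M : fus L (K `|` M) = fus L K `|` fus L M.
Proof.
apply/seteqP; split; last first.
  by rewrite subUset; split; apply: fusionSS.
by move=> z [x [y [Lx [Ky|My] xy ->]]]; [left|right]; exists x, y.
Qed.

Lemma fusion_bigcupl (F : nat -> lang Sigma T) K :
  fus (\bigcup_(n in [set: nat]) F n) K = \bigcup_(n in [set: nat]) fus (F n) K.
Proof.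
apply/seteqP; split=> [z [x [y [[n _ Fx] Ky xy ->]]]|z [n _ [x [y [Fx Ky xy ->]]]]].
  by exists n => //; exists x, y.
by exists x, y; split=> //; exists n.
Qed.

Lemma fusion_bigcupr (F : nat -> lang Sigma T) K :
  fus K (\bigcup_(n in [set: nat]) F n) = \bigcup_(n in [set: nat]) fus K (F n).
Proof.
apply/seteqP; split=> [z [x [y [Kx [n _ Fy] xy ->]]]|z [n _ [x [y [Kx Fy xy ->]]]]].
  by exists n => //; exists x, y.
by exists x, y; split=> //; exists n.
Qed.

Lemma fusion0l L : fus set0 L = set0.
Proof. by apply/seteqP; split=> // z [x [y []]]. Qed.

Lemma fusion0r L : fus L set0 = set0.
Proof. by apply/seteqP; split=> // z [x [y []]]. Qed.

Lemma atoms_lang0 : @atoms_lang Sigma T set0 = set0.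
Proof. by apply/seteqP; split=> // z []. Qed.

Lemma fusion_atoms B C :
  fus (atoms_lang B) (atoms_lang C) = atoms_lang (B `&` C).
Proof.
rewrite fusion_guardE; apply/seteqP; split=> x.
  by case=> Bx [alpha Calpha xE]; exists alpha => //; split=> //;
    rewrite xE in Bx.
by case=> alpha [Balpha Calpha] ->; split=> //; exists alpha.
Qed.

(** [lang_pow] grows on the right, whereas loops unroll on the left; associativity reconciles the
    two. *)
Lemma lang_powSl L n : lang_pow L n.+1 = fus L (lang_pow L n).
Proof.
elim: n => [|n IHn]; first by rewrite /= fusion1l fusion1r.
by rewrite -[LHS]/(fus (lang_pow L n.+1) L) {1}IHn fusionA.
Qed.

Lemma lang_star_unfold L : lang_star L = 1 `|` fus L (lang_star L).
Proof.
rewrite fusion_bigcupr; apply/seteqP; split=> [x [[|n] _]|x [Lx|[n _ Lx]]].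
- by left.
- by rewrite lang_powSl; right; exists n.
- by exists 0.
by exists n.+1 => //; rewrite lang_powSl.
Qed.

(** The left induction rule of Kleene algebra, obtained by induction on the number of iterations. *)
Lemma lang_star_ind L K X :
  K `<=` X -> fus L X `<=` X -> fus (lang_star L) K `<=` X.
Proof.
move=> KX LX; rewrite fusion_bigcupl => x [n _]; elim: n x => [|n IHn] x.
  by rewrite /= fusion1l => /KX.
rewrite lang_powSl fusionA => H; apply: LX; move: x H.
exact: fusionSS.
Qed.

Lemma lang_star_sub1 L : 1 `<=` lang_star L.
Proof. by rewrite lang_star_unfold => x; left. Qed.

Lemma lang_star_subS L : fus L (lang_star L) `<=` lang_star L.
Proof. by rewrite [X in _ `<=` X]lang_star_unfold => x; right. Qed.

Lemma lang_starU_atoms L C : lang_star (L `|` atoms_lang C) = lang_star L.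
Proof.
(* Fusing the smaller star with [1] on the right gives it the shape required by [lang_star_ind]. *)
apply/seteqP; split; rewrite -[X in X `<=` _]fusion1r;
    apply: lang_star_ind; try exact: lang_star_sub1.
  rewrite fusionUl subUset; split; first exact: lang_star_subS.
  by rewrite fusion_guardE => x [].
apply: subset_trans (@lang_star_subS _).
by apply: fusionSS => // x; left.
Qed.

Lemma lang_whileE B L :
  lang_while B L = fus (lang_star (fus (atoms_lang B) L)) (atoms_lang (~` B)).
Proof. by rewrite fusion_bigcupl. Qed.

Lemma lang_iteE B L K :
  lang_ite B L K = [set x | B x.1 /\ L x] `|` [set x | ~ B x.1 /\ K x].
Proof. by rewrite /lang_ite !fusion_guardE. Qed.

Lemma lang_while_unfold B L :
  lang_while B L = lang_ite B (fus L (lang_while B L)) 1.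
Proof.
rewrite /lang_ite fusion1r {1}lang_whileE lang_star_unfold fusionUl fusion1l.
by rewrite setUC !fusionA -lang_whileE.
Qed.

Lemma lang_ite_fixpoint B L K X : (forall x, L x -> x.2 <> [::]) ->
  X = lang_ite B (fus L X) K -> X = fus (lang_while B L) K.
Proof.
move=> Lpos XE.
(* The candidate solution satisfies the same equation as [X], so both can be unrolled in
   lockstep. *)
have WE : fus (lang_while B L) K
    = lang_ite B (fus L (fus (lang_while B L) K)) K.
  rewrite {1}lang_while_unfold /lang_ite fusionUl fusion1r.
  by rewrite !fusionA.
apply/seteqP; split.
  suff H n x : size x.2 < n -> X x -> fus (lang_while B L) K x.
    by move=> x; apply: H (ltnSn _).
  elim: n x => // n IHn x ltn; rewrite {1}XE WE !lang_iteE => -[[Bx]|]; last by right.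
  move=> [y [z [Ly Xz yz xE]]]; left; split=> //; exists y, z; split=> //.
  apply: IHn => //; move: ltn; rewrite xE /= size_cat ltnS; apply: leq_trans.
  by rewrite -[X in X < _]add0n ltn_add2r lt0n; apply/nilP/Lpos.
(* Conversely, the loop followed by [K] lies below [X] by star induction, each premise being one
   half of the equation for [X]. *)
rewrite lang_whileE fusionA; apply: lang_star_ind.
  by rewrite [X in _ `<=` X]XE => x; right.
by rewrite fusionA [X in _ `<=` X]XE => x; left.
Qed.

End Languages.

(** * Soundness of the rules *)

Section Soundness.
Variables Sigma T : Type.
Implicit Types e f g : exp Sigma T.

(** A fusion is a single atom only if both factors are that same atom. W3 uses the contrapositive:
    if [E e] denotes no atom, every string of [e] contains an action. *)
Lemma sem_atom_E e alpha : sem e (alpha, [::]) -> bsem (E e) alpha.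
Proof.
elim: e alpha => [p|b|e IHe f IHf|b e IHe f IHf|b e _] alpha /=.
- by case=> ? [].
- by case=> beta Hb [->].
- rewrite bsem_and => -[[a1 s1] [[a2 s2] [He Hf xy]]] [-> /esym/nilP].
  rewrite /nilp size_cat addn_eq0 => /andP[/nilP /= s10 /nilP /= s20].
  rewrite /gs_last /gs_first s10 s20 /= in He Hf xy *; rewrite -xy in Hf.
  by split; [apply: IHe|apply: IHf].
- rewrite bsem_or !bsem_and bsem_not lang_iteE /=.
  by case=> -[Hb H]; [left|right]; split=> //; [apply: IHe|apply: IHf].
(* If the loop is entered, the remaining string is again the single atom [alpha] and belongs to the
   loop. It ends in an atom outside [b], which can only be [alpha]. *)
rewrite bsem_not lang_while_unfold lang_iteE /= => -[[Bx]|[]//].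
move=> [[a1 s1] [[a2 s2] [_ + xy]]] [-> /esym/nilP].
rewrite /nilp size_cat addn_eq0 => + /andP[/nilP /= s10 /nilP /= s20].
rewrite /gs_last /gs_first s10 s20 /= in xy *; rewrite -xy lang_whileE.
move=> [[c1 t1] [y [_ [beta nB ->] /= cy]]] [-> /esym/nilP].
rewrite cats0 => /nilP t10; rewrite t10 /gs_last /gs_first /= in cy.
by rewrite cy.
Qed.

Lemma gkat_sound e f : e =GKAT= f -> sem e = sem f.
Proof.
elim=> {e f} /=.
- by [].
- by [].
- by move=> e f g _ -> _ ->.
- by move=> b b' c c' _ /atoms_lang_inj bb _ /atoms_lang_inj cc;
    rewrite !bsem_and bb cc.
- by move=> b b' c c' _ /atoms_lang_inj bb _ /atoms_lang_inj cc;
    rewrite !bsem_or bb cc.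
- by move=> b b' _ /atoms_lang_inj bb; rewrite !bsem_not bb.
- by move=> e e' f f' _ -> _ ->.
- by move=> b b' e e' f f' _ /atoms_lang_inj -> _ -> _ ->.
- by move=> b b' e e' _ /atoms_lang_inj -> _ ->.
- by move=> b c; rewrite fusion_atoms bsem_and.
- by move=> b c /bsem_equiv ->.
- move=> b e; rewrite lang_iteE; apply/seteqP; split=> [x [[]|[]]//|x ex].
  by case: (EM (bsem b x.1)) => Hb; [left|right].
- by move=> b e f; rewrite /lang_ite bsem_not setCK setUC.
- move=> b c e f g; rewrite !lang_iteE bsem_and; apply/seteqP; split=> x /=;
    case: (EM (bsem b x.1)); case: (EM (bsem c x.1)); tauto.
- move=> b e f; rewrite !lang_iteE fusion_guardE; apply/seteqP; split=> x /=;
    tauto.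
- by move=> b e f g; rewrite /lang_ite fusionUl !fusionA.
- by move=> e f g; rewrite fusionA.
- by move=> e; rewrite bsem0 atoms_lang0 fusion0l.
- by move=> e; rewrite bsem0 atoms_lang0 fusion0r.
- by move=> e; rewrite bsem1 fusion1l.
- by move=> e; rewrite bsem1 fusion1r.
- by move=> b e; rewrite bsem1 -lang_while_unfold.
(* W2: the guarded body on the left is that on the right together with the atoms in [b] but not in
   [c], which the star absorbs. *)
- move=> b c e; rewrite !lang_whileE /lang_ite bsem1 fusion1r fusionUr.
  by rewrite fusion_atoms lang_starU_atoms.
(* W3: a single atom in [sem e] would lie in [bsem (E e)], which [E0] makes empty. *)
move=> b e f g _ gE _ /atoms_lang_inj E0; apply: lang_ite_fixpoint gE.
move=> [alpha [|//]] /sem_atom_E.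
by rewrite E0 bsem0.
Qed.

End Soundness.

Theorem theorem3p3 (Sigma : Type) (T : finType) (hSigma : inhabited Sigma)
    (hT : 0 < #|T|) (e f : exp Sigma T) :
  gkat_equiv e f -> sem e = sem f.
Proof. exact: gkat_sound. Qed.
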